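(* Let $\lambda,\mu\in P^+$ be such that $\langle\alpha_i^\vee,\mu\rangle=0$ whenever $\langle\alpha_i^\vee,\lambda\rangle=0$, and let $u,v\in W$ with $u\preceq v$. Then \[\mathcal{F}(\{b_\lambda\otimes b_\mu\})\cap\big(\mathcal{B}_u(\lambda)\otimes\mathcal{B}_v(\mu)\big)\cong\mathcal{B}_u(\lambda+\mu),\] where the isomorphism is induced by the crystal isomorphism between the connected component $\mathcal{F}(\{b_\lambda\otimes b_\mu\})$ and $\mathcal{B}(\lambda+\mu)$.
   Context: $\mathfrak g$ is a complex semisimple Lie algebra with Dynkin index set $I$, simple coroots $\alpha_i^\vee$, dominant weights $P^+$, Weyl group $W$ generated by simple reflections $s_i$ with Bruhat order $\preceq$. For $\lambda\in P^+$, $\mathcal{B}(\lambda)$ is Kashiwara's crystal of the irreducible module of highest weight $\lambda$ with operators $e_i,f_i$, $\varepsilon_i(b)=\max\{k:e_i^k(b)\ne0\}$, $\varphi_i(b)=\max\{k:f_i^k(b)\ne0\}$, and highest weight element $b_\lambda$. For $w$ with any reduced expression $s_{i_1}\cdots s_{i_\ell}$, $\mathcal{B}_w(\lambda)=\{f_{i_1}^{m_1}\cdots f_{i_\ell}^{m_\ell}(b_\lambda):m_j\ge0\}\setminus\{0\}$. Tensor product rule: $e_i(b_1\otimes b_2)=e_i(b_1)\otimes b_2$ if $\varepsilon_i(b_2)\le\varphi_i(b_1)$, else $b_1\otimes e_i(b_2)$; $f_i(b_1\otimes b_2)=f_i(b_1)\otimes b_2$ if $\varepsilon_i(b_2)<\varphi_i(b_1)$,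 else $b_1\otimes f_i(b_2)$. $\mathcal{F}(\{b\})$ denotes the set of all nonzero elements obtained from $b$ by applying finite sequences of operators $f_i$ (including $b$); $\mathcal{F}(\{b_\lambda\otimes b_\mu\})$ is a connected component of $\mathcal{B}(\lambda)\otimes\mathcal{B}(\mu)$ isomorphic to $\mathcal{B}(\lambda+\mu)$. *)

(* Defs.v *)
From HB Require Import structures.
From mathcomp Require Import all_boot all_order all_algebra.
Set Implicit Arguments. Unset Strict Implicit. Unset Printing Implicit Defensive.
Import Order.TTheory GRing.Theory Num.Theory.
Local Open Scope ring_scope.

Section Defs.
Variable I : finType.

(* A i j = < alpha_i^vee, alpha_j >.  Finite type: generalized Cartan matrix
   that is symmetrizable with positive definite symmetrization. *)
Definition finite_cartan (A : I -> I -> int) : Prop :=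
  [/\ (forall i, A i i = 2),
      (forall i j, i != j -> A i j <= 0),
      (forall i j, A i j = 0 -> A j i = 0) &
      exists d : I -> int,
        [/\ (forall i, 0 < d i),
            (forall i j, d i * A i j = d j * A j i) &
            forall x : I -> rat, (exists i, x i != 0) ->
              0 < \sum_i \sum_j x i * ((d i * A i j)%:~R) * x j]].

(* Weight lattice P, in coordinates w.r.t. the fundamental weights:
   l i = < alpha_i^vee, l >. *)
Definition weight := {ffun I -> int}.
Definition wadd (l m : weight) : weight := [ffun j => l j + m j].
(* simple root alpha_i : < alpha_j^vee, alpha_i > = A j i *)
Definition alpha (A : I -> I -> int) (i : I) : weight := [ffun j => A j i].
Definition wsub (l m : weight) : weight := [ffun j => l j - m j].
Definition dominant (l : weight) : Prop := forall i, 0 <= l i.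

(* s_i l = l - <alpha_i^vee, l> alpha_i *)
Definition sref (A : I -> I -> int) (i : I) (l : weight) : weight :=
  [ffun j => l j - l i * A j i].
(* the word [:: i1; ...; ik] stands for s_i1 ... s_ik *)
Definition wact (A : I -> I -> int) (w : seq I) (l : weight) : weight :=
  foldr (sref A) l w.
(* two words represent the same element of W (W acting faithfully on P) *)
Definition weq A (w1 w2 : seq I) : Prop := forall l, wact A w1 l = wact A w2 l.
Definition is_length A (w : seq I) (n : nat) : Prop :=
  (exists w', weq A w' w /\ size w' = n) /\
  (forall w', weq A w' w -> (n <= size w')%N).
Definition length_lt A (x y : seq I) : Prop :=
  forall nx ny, is_length A x nx -> is_length A y ny -> (nx < ny)%N.
Definition reduced A (w : seq I) : Prop := is_length A w (size w).
(* x -> y iff y = x t with t a reflection (conjugate of a simple reflection)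
   and l(x) < l(y) *)
Definition bruhat_step A (x y : seq I) : Prop :=
  exists (r : seq I) (i : I), weq A y (x ++ r ++ i :: rev r) /\ length_lt A x y.
Inductive bruhat_le A (u : seq I) : seq I -> Prop :=
  | bruhat_refl v : weq A u v -> bruhat_le A u v
  | bruhat_trans w v : bruhat_le A u w -> bruhat_step A w v -> bruhat_le A u v.

Definition opow (T : Type) (g : T -> option T) (k : nat) (b : T) : option T :=
  iter k (obind g) (Some b).

(* epsilon_i / phi_i := length of the e_i / f_i string (strings in a finite
   crystal with weight axiom have length < #|T|, so the bounded max is the max) *)
Definition strlen (T : finType) (g : T -> option T) (b : T) : nat :=
  \max_(k < #|T| | opow g k b != None) (k : nat).

(* tensor product rule (Kashiwara convention) *)
Definition tens_e (T1 T2 : finType) (e1 f1 : I -> T1 -> option T1)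
  (e2 : I -> T2 -> option T2) (i : I) (b : T1 * T2) : option (T1 * T2) :=
  if (strlen (e2 i) b.2 <= strlen (f1 i) b.1)%N
  then omap (fun x => (x, b.2)) (e1 i b.1)
  else omap (fun y => (b.1, y)) (e2 i b.2).
Definition tens_f (T1 T2 : finType) (f1 : I -> T1 -> option T1)
  (e2 f2 : I -> T2 -> option T2) (i : I) (b : T1 * T2) : option (T1 * T2) :=
  if (strlen (e2 i) b.2 < strlen (f1 i) b.1)%N
  then omap (fun x => (x, b.2)) (f1 i b.1)
  else omap (fun y => (b.1, y)) (f2 i b.2).

Inductive freach (T : Type) (f : I -> T -> option T) (b0 : T) : T -> Prop :=
  | freach0 : freach f b0 b0
  | freachS b b' i : freach f b0 b -> f i b = Some b' -> freach f b0 b'.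

Fixpoint demazure (T : Type) (f : I -> T -> option T) (b0 : T) (w : seq I)
  (b : T) : Prop :=
  match w with
  | [::] => b = b0
  | i :: w' => exists b' m, demazure f b0 w' b' /\ opow (f i) m b' = Some b
  end.

Record crystal_family := CrystalFamily {
  cB : weight -> finType;
  ce : forall l, I -> cB l -> option (cB l);
  cf : forall l, I -> cB l -> option (cB l);
  cwt : forall l, cB l -> weight;
  chw : forall l, cB l }.

Definition comp_iso (C : crystal_family) (l m : weight)
  (psi : cB C (wadd l m) -> cB C l * cB C m) : Prop :=
  [/\ injective psi,
      (forall x, freach (tens_f (cf (l:=l)) (ce (l:=m)) (cf (l:=m)))
                        (chw C l, chw C m) x <-> exists b, psi b = x),
      (forall i b, omap psi (cf i b) = tens_f (cf (l:=l)) (ce (l:=m)) (cf (l:=m)) i (psi b)),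
      (forall i b, omap psi (ce i b) =
                   tens_e (ce (l:=l)) (cf (l:=l)) (ce (l:=m)) i (psi b)) &
      (forall b, cwt b = wadd (cwt (psi b).1) (cwt (psi b).2))].

(* Characterization of Kashiwara's crystals B(l), l in P+ (Joseph's
   uniqueness theorem for closed families of normal highest weight crystals) *)
Definition kashiwara_family A (C : crystal_family) : Prop :=
  (forall l, dominant l ->
     [/\ (forall i (b b' : cB C l), cf i b = Some b' <-> ce i b' = Some b),
         (forall i (b b' : cB C l), cf i b = Some b' ->
                       cwt b' = wsub (cwt b) (alpha A i)),
         (forall i (b : cB C l), (strlen (cf i) b : int) - (strlen (ce i) b : int)
                                 = cwt b i),
         cwt (chw C l) = l /\ (forall i, ce i (chw C l) = None) &
         (forall b : cB C l, freach (cf (l:=l)) (chw C l) b)]) /\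
  (forall l m, dominant l -> dominant m -> exists psi, comp_iso (C:=C) (l:=l) (m:=m) psi).

End Defs.

(* Main.v *)
(* The main component of B(l) (x) B(m) is e-stable, and raising b1 (x) b2 along
   its i-string to the top raises the factor b1 to the top of its own i-string.
   Hence, once Demazure subsets B_u(l) are known to be stable under the e_i,
   membership of b in B_u(l + m) can be read on b1, by induction on the word u.

   Stability under the e_i follows by induction on the word from the right: for
   l with l_i = 0 and l_j > 0 otherwise, B_{w s_i}(l + m) consists of the b with
   b1 in B_w(l), a condition visibly preserved by the tensor product rule; and
   B(l) embeds in B(l + rho) as b |-> b (x) b_rho.

   The monotonicity B_u(m) <= B_v(m) for u <= v uses a description of B_w(m)
   that depends only on the Weyl group element w: it is the set of those b for
   which x (x) b lies in the main component of B(rho) (x) B(m) for some x of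
   weight w rho. Together with the strong
   exchange property this reduces Bruhat steps to deleting a letter. *)
Require Import Defs.
From HB Require Import structures.
From mathcomp Require Import all_boot all_order all_algebra.
From mathcomp Require Import ring zify.
From Stdlib Require Import Classical.
Set Implicit Arguments. Unset Strict Implicit. Unset Printing Implicit Defensive.
Import Order.TTheory GRing.Theory Num.Theory.
Local Open Scope ring_scope.

(** * String lengths of a partial map that lowers an integer statistic *)

Section StringLength.
Variables (T : finType) (g : T -> option T) (h : T -> int).
Hypothesis g_dec : forall b b', g b = Some b' -> h b' < h b.

Lemma opowSr k b :
  opow g k.+1 b = if g b is Some b' then opow g k b' else None.
Proof.
rewrite /opow iterSr /=; case: (g b) => //=.
by elim: k => //= k ->.
Qed.

Lemma opow_dec k b b' : opow g k b = Some b' -> h b' + k%:Z <= h b.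
Proof.
elim: k b => [|k IH] b; first by case=> <-; rewrite addr0.
rewrite opowSr; case E: (g b) => [c|//] /IH; have := g_dec E; lia.
Qed.

Lemma opow_leq j k b : (j <= k)%N -> opow g k b != None -> opow g j b != None.
Proof.
move=> /subnKC <-; elim: (k - j)%N => [|n IH]; first by rewrite addn0.
by rewrite addnS /opow iterS -/(opow g _ b) => H; apply: IH; case: opow H.
Qed.

(** [h] drops strictly, so the iterates of [b] are distinct; hence the bound [#|T|] built into
    [strlen] never truncates a string. *)
Lemma opow_lt_card k b : opow g k b != None -> (k < #|T|)%N.
Proof.
move=> Hk; rewrite -[k.+1]card_ord.
pose F (i : 'I_k.+1) := odflt b (opow g i b).
have hF (i : 'I_k.+1) : opow g i b = Some (F i).
  have := opow_leq (ltn_ord i : i <= k)%N Hk; rewrite /F; by case: opow.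
apply: (@leq_card _ _ F); move=> i j Fij.
wlog ij : i j Fij / (i <= j)%N.
  by move=> W; case/orP: (leq_total i j) => [/W|/W H]; [apply | rewrite H].
apply/val_inj/eqP; rewrite eqn_leq ij /= leqNgt; apply/negP => lt_ij.
have := hF j; rewrite -(subnKC ij) /opow addnC iterD -/(opow g i b) hF Fij.
by move/opow_dec; rewrite gerDl lez_nat; lia.
Qed.

Lemma leq_strlen k b : (k <= strlen g b)%N = (opow g k b != None).
Proof.
apply/idP/idP => [|Hk]; last first.
  exact: (leq_bigmax_cond (Ordinal (opow_lt_card Hk))).
apply: contraLR => /negbNE Hk.
have k_gt0 : (0 < k)%N by case: k Hk.
rewrite -ltnNge -(prednK k_gt0) ltnS; apply/bigmax_leqP => i Hi.
rewrite -ltnS (prednK k_gt0) ltnNge; apply/negP => ki.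
by have := opow_leq ki Hi; rewrite (eqP Hk).
Qed.

Lemma strlen_Some b b' : g b = Some b' -> strlen g b = (strlen g b').+1.
Proof.
move=> E; have H k : (k.+1 <= strlen g b)%N = (k <= strlen g b')%N.
  by rewrite !leq_strlen opowSr E.
by apply/eqP; rewrite eqn_leq H leqnn andbT; move: (H (strlen g b).-1); lia.
Qed.

Lemma strlen_eq0 b : (strlen g b == 0%N) = (g b == None).
Proof.
by apply: negb_inj; rewrite -lt0n leq_strlen opowSr; case: (g b).
Qed.

Definition step b := odflt b (g b).

Lemma opow_iterP m b b' :
  opow g m b = Some b' <-> (m <= strlen g b)%N /\ b' = iter m step b.
Proof.
elim: m b => [|m IH] b; first by split=> [[->]|[_ ->]].
rewrite opowSr iterSr /step; case E: (g b) => [c|] /=.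
  by rewrite IH (strlen_Some E) ltnS.
have /eqP -> : strlen g b == 0%N by rewrite strlen_eq0 E.
by split=> // -[].
Qed.

End StringLength.

(** * Strings of mutually inverse raising and lowering operators *)

Section Strings.
Variables (T : finType) (e f : T -> option T) (h : T -> int).
Hypothesis ef : forall b b', f b = Some b' <-> e b' = Some b.
Hypothesis f_dec : forall b b', f b = Some b' -> h b' < h b.

Let e_inc b b' : e b = Some b' -> - h b' < - h b.
Proof. by move/ef/f_dec; rewrite ltrN2. Qed.

Definition top b := iter (strlen e b) (step e) b.

Lemma top_e b b' : e b = Some b' -> top b = top b'.
Proof.
by move=> E; rewrite /top (strlen_Some e_inc E) iterSr /step E.
Qed.

Lemma top_id b : strlen e b = 0%N -> top b = b.
Proof. by rewrite /top => ->. Qed.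

Lemma top_ind (P : T -> Prop) :
  (forall b, e b = None -> P b) ->
  (forall b b', e b = Some b' -> P b' -> P b) -> forall b, P b.
Proof.
move=> P0 PS b; elim: (strlen e b) {-2}b (erefl (strlen e b)) => {b} [|n IH] b.
  by move/eqP; rewrite (strlen_eq0 e_inc) => /eqP /P0.
case E: (e b) => [b'|]; last by move=> _; apply: P0.
by rewrite (strlen_Some e_inc E) => -[] /IH; apply: PS.
Qed.

Lemma strlen_e_top b : strlen e (top b) = 0%N.
Proof.
elim/top_ind: b => [b Eb|b b' Eb]; last by rewrite (top_e Eb).
have /eqP e0 : strlen e b == 0%N by rewrite (strlen_eq0 e_inc) Eb.
by rewrite top_id.
Qed.

Lemma strlen_step b : (0 < strlen f b)%N ->
  [/\ f b = Some (step f b), strlen f b = (strlen f (step f b)).+1 &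
      strlen e (step f b) = (strlen e b).+1].
Proof.
rewrite lt0n (strlen_eq0 f_dec) /step; case E: (f b) => [c|] //= _.
by rewrite (strlen_Some f_dec E); split=> //; apply: (strlen_Some e_inc); apply/ef.
Qed.

Lemma step_id b : strlen f b = 0%N -> step f b = b.
Proof. by move/eqP; rewrite (strlen_eq0 f_dec) /step => /eqP ->. Qed.

Lemma iter_stepP k b : (k <= strlen f b)%N ->
  [/\ strlen f (iter k (step f) b) = (strlen f b - k)%N,
      strlen e (iter k (step f) b) = (strlen e b + k)%N &
      top (iter k (step f) b) = top b].
Proof.
elim: k => [|k IH] kb /=; first by rewrite subn0 addn0.
have [E1 E2 E3] := IH (ltnW kb).
have [|H1 H2 H3] := @strlen_step (iter k (step f) b); first by rewrite E1 subn_gt0.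
split; [lia | lia |].
by rewrite -E3; apply: top_e; apply/ef.
Qed.

Lemma iter_step_top b : iter (strlen e b) (step f) (top b) = b.
Proof.
elim/top_ind: b => [b Eb|b b' Eb IH].
  have /eqP e0 : strlen e b == 0%N by rewrite (strlen_eq0 e_inc) Eb.
  by rewrite top_id ?e0.
rewrite (top_e Eb) (strlen_Some e_inc Eb) iterS IH /step.
by have /ef -> := Eb.
Qed.

Lemma strlen_f_top b : strlen f (top b) = (strlen e b + strlen f b)%N.
Proof.
elim/top_ind: b => [b Eb|b b' Eb IH].
  have /eqP e0 : strlen e b == 0%N by rewrite (strlen_eq0 e_inc) Eb.
  by rewrite top_id ?e0.
rewrite (top_e Eb) IH (strlen_Some e_inc Eb).
by move/ef: Eb => /(strlen_Some f_dec) ->; lia.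
Qed.

Lemma opow_top b : opow f (strlen e b) (top b) = Some b.
Proof. by apply/(opow_iterP f_dec); rewrite strlen_f_top leq_addr iter_step_top. Qed.

Lemma opow_eq_top m b b' : opow f m b = Some b' -> top b' = top b.
Proof. by case/(opow_iterP f_dec) => mb ->; case: (iter_stepP mb). Qed.

(* Kashiwara's reflection of the string through b: the position is
   strlen e b, and the reflected element sits at position strlen f b. *)
Definition srefl b := iter (strlen f b) (step f) (top b).

Lemma sreflP b : [/\ strlen e (srefl b) = strlen f b,
  strlen f (srefl b) = strlen e b & top (srefl b) = top b].
Proof.
have le : (strlen f b <= strlen f (top b))%N by rewrite strlen_f_top leq_addl.
have [E1 E2 E3] := iter_stepP le.
rewrite /srefl E1 E2 E3 strlen_f_top strlen_e_top addnK add0n; split=> //.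
by rewrite top_id ?strlen_e_top.
Qed.

End Strings.

Lemma wsubE (I : finType) (l m : weight I) : wsub l m = l - m.
Proof. by apply/ffunP => j; rewrite !ffunE. Qed.

(** * Weyl group action on weights and reduced words *)

Section WeylAction.
Variables (I : finType) (A : I -> I -> int).
Hypothesis A2 : forall i, A i i = 2.

Lemma srefB i : {morph sref A i : a b / a - b}.
Proof. by move=> a b; apply/ffunP => j; rewrite !ffunE; ring. Qed.

Lemma srefK i : involutive (sref A i).
Proof. by move=> a; apply/ffunP => j; rewrite !ffunE A2; ring. Qed.

Lemma wact_cat w1 w2 a : wact A (w1 ++ w2) a = wact A w1 (wact A w2 a).
Proof. exact: foldr_cat. Qed.

Lemma wactB w : {morph wact A w : a b / a - b}.
Proof. by elim: w => // i w IH a b; rewrite /= IH srefB. Qed.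

Lemma wactN w : {morph wact A w : a / - a}.
Proof.
have w0 : wact A w 0 = 0 by have := wactB w 0 0; rewrite !subrr.
by move=> a; rewrite -[- a]sub0r wactB w0 sub0r.
Qed.

Lemma wact_revK w a : wact A w (wact A (rev w) a) = a.
Proof.
elim: w a => // i w IH a.
by rewrite rev_cons -cats1 wact_cat /= IH srefK.
Qed.

Lemma wact_revKV w a : wact A (rev w) (wact A w a) = a.
Proof. by rewrite -{2}(revK w) wact_revK. Qed.

(** Classical descent on the size of a word, as [weq] is only a proposition. *)
Lemma exists_length w : exists n, is_length A w n.
Proof.
suff H n : forall w', weq A w' w -> (size w' <= n)%N ->
    exists n, is_length A w n by apply: (H (size w) w).
elim: n => [|n IH] w' ww' le.
  exists 0%N; split=> //; exists w'; split=> //; lia.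
have [[z [zw lt]]|H] := classic (exists z, weq A z w /\ (size z < size w')%N).
  by apply: (IH z zw); lia.
exists (size w'); split; first by exists w'.
by move=> z zw; rewrite leqNgt; apply/negP => lt; apply: H; exists z.
Qed.

Lemma exists_reduced w : exists z, weq A z w /\ reduced A z.
Proof.
have [n [[z [zw <-]] H]] := exists_length w; exists z; split=> //.
by split=> [|z' z'z]; [exists z | apply: H => l; rewrite z'z zw].
Qed.

Lemma reduced_tail i w : reduced A (i :: w) -> reduced A w.
Proof.
move=> [_ H]; split=> [|z zw]; first by exists w.
by have := H (i :: z); rewrite ltnS; apply=> l /=; rewrite zw.
Qed.

End WeylAction.

(* The root lattice is handled in coordinates: c stands for the element
   sum_k (c k) alpha_k, rsref is the simple reflection on it and rwt its
   inclusion in the weight lattice. *)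
Section Roots.
Variables (I : finType) (A : I -> I -> int).
Hypothesis A2 : forall i, A i i = 2.

Definition sroot (i : I) : weight I := [ffun k => (k == i)%:R].
Definition rwt (c : weight I) : weight I := [ffun j => \sum_k A j k * c k].
Definition rsref (i : I) (c : weight I) : weight I :=
  [ffun j => c j - rwt c i * (j == i)%:R].
Definition rwact (w : seq I) (c : weight I) : weight I := foldr rsref c w.

Lemma sum_delta (F : I -> int) i : \sum_k F k * (k == i)%:R = F i.
Proof.
rewrite (bigD1 i) //= eqxx mulr1 big1 ?addr0 // => k /negPf ->.
by rewrite mulr0.
Qed.

Lemma rwt_sroot i : rwt (sroot i) = alpha A i.
Proof.
apply/ffunP => j; rewrite !ffunE -[RHS](sum_delta (A j)).
by apply: eq_bigr => k _; rewrite ffunE.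
Qed.

Lemma rwtB : {morph rwt : a b / a - b}.
Proof.
move=> a b; apply/ffunP => j; rewrite !ffunE -sumrB.
by apply: eq_bigr => k _; rewrite !ffunE mulrBr.
Qed.

Lemma rwtN : {morph rwt : a / - a}.
Proof.
move=> a; apply/ffunP => j; rewrite !ffunE -sumrN.
by apply: eq_bigr => k _; rewrite !ffunE mulrN.
Qed.

Lemma rwtMn k : {morph rwt : a / a *+ k}.
Proof.
move=> a; apply/ffunP => j; rewrite ffunMnE 2!ffunE -sumrMnl.
by apply: eq_bigr => k' _; rewrite ffunMnE mulrnAr.
Qed.

Lemma rwt_rsref i c : rwt (rsref i c) = sref A i (rwt c).
Proof.
apply/ffunP => j; rewrite 2!ffunE.
rewrite (eq_bigr (fun k => A j k * c k - rwt c i * A j k * (k == i)%:R)).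
  by rewrite sumrB (sum_delta (fun k => rwt c i * A j k)) [rwt c j]ffunE.
by move=> k _; rewrite ffunE; ring.
Qed.

Lemma rwt_rwact w c : rwt (rwact w c) = wact A w (rwt c).
Proof. by elim: w => //= i w IH; rewrite rwt_rsref IH. Qed.

Lemma rwact_cat w1 w2 c : rwact (w1 ++ w2) c = rwact w1 (rwact w2 c).
Proof. exact: foldr_cat. Qed.

Lemma rsrefK i : involutive (rsref i).
Proof.
move=> c; apply/ffunP => j; rewrite ffunE rwt_rsref [rsref i c j]ffunE [sref _ _ _ i]ffunE A2; ring.
Qed.

Lemma rwact_revK w c : rwact w (rwact (rev w) c) = c.
Proof.
elim: w c => // i w IH c.
by rewrite rev_cons -cats1 rwact_cat /= IH rsrefK.
Qed.

Lemma rwact_revKV w c : rwact (rev w) (rwact w c) = c.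
Proof. by rewrite -{2}(revK w) rwact_revK. Qed.

Lemma rsref_sroot i : rsref i (sroot i) = - sroot i.
Proof.
by apply/ffunP => j; rewrite ffunE rwt_sroot !ffunE A2; ring.
Qed.

Lemma rwactN w : {morph rwact w : c / - c}.
Proof.
elim: w => // i w IH c /=; rewrite IH.
by apply/ffunP => j; rewrite !(ffunE, rwtN); ring.
Qed.

Lemma rwact_sroot_neq0 w i : rwact w (sroot i) != 0.
Proof.
apply/eqP => E; have := rwact_revKV w (sroot i); rewrite E.
have -> : rwact (rev w) 0 = 0.
  elim: (rev w) => //= j z ->; apply/ffunP => k.
  rewrite !ffunE big1 ?mul0r ?subr0 // => k' _.
  by rewrite ffunE mulr0.
by move/ffunP/(_ i); rewrite !ffunE eqxx.
Qed.

(** * The invariant form, reflections and the exchange property *)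

Variable d : I -> int.
Hypothesis d_gt0 : forall i, 0 < d i.
Hypothesis dA : forall i j, d i * A i j = d j * A j i.
Hypothesis posdef : forall x : I -> rat, (exists i, x i != 0) ->
  0 < \sum_i \sum_j x i * ((d i * A i j)%:~R) * x j.

(** A nonzero kernel vector would have norm zero, against positive definiteness. *)
Lemma rwt_inj : injective rwt.
Proof.
move=> a b /eqP; rewrite -subr_eq0 -rwtB => /eqP /ffunP E.
apply/eqP; rewrite -subr_eq0; apply/negPn/negP => /eqP Hc.
move: (a - b) E Hc => c E Hc; suff /posdef : exists i, (c i)%:~R != 0 :> rat.
  rewrite big1 ?ltxx // => i _.
  have := E i; rewrite [rwt c i]ffunE [RHS]ffunE => Ei.
  transitivity ((d i * c i * \sum_k A i k * c k)%:~R : rat); last by rewrite Ei mulr0.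
  rewrite mulr_sumr rmorph_sum; apply: eq_bigr => j _ /=.
  by rewrite -!intrM; congr (_%:~R); ring.
apply: NNPP => H; apply: Hc; apply/ffunP => i; rewrite [RHS]ffunE.
apply: NNPP => ci; apply: H; exists i; rewrite intr_eq0; exact/eqP.
Qed.

(* d-weighted pairing: pr c n is the invariant form (sum_k c_k alpha_k, n). *)
Definition pr (c n : weight I) := \sum_k d k * c k * n k.

Lemma pr_rsref i c n : pr (rsref i c) n = pr c (sref A i n).
Proof.
rewrite /pr.
rewrite (eq_bigr (fun k => d k * c k * n k - d k * rwt c i * n k * (k == i)%:R));
  last by move=> k _; rewrite [rsref i c k]ffunE; ring.
rewrite sumrB (sum_delta (fun k => d k * rwt c i * n k)).
rewrite [RHS](eq_bigr (fun k => d k * c k * n k - n i * d i * (A i k * c k)));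
  last by move=> k _; rewrite [sref A i n k]ffunE mulrBr;
          congr (_ - _); rewrite -[n i * d i * _]mulrA (mulrA (d i)) dA; ring.
by rewrite sumrB -mulr_sumr [rwt c i]ffunE; ring.
Qed.

Lemma pr_rwact w c n : pr (rwact w c) n = pr c (wact A (rev w) n).
Proof.
elim: w n => // i w IH n.
by rewrite /= pr_rsref IH rev_cons -cats1 wact_cat.
Qed.

Lemma pr_sroot i n : pr (sroot i) n = d i * n i.
Proof.
rewrite /pr -(sum_delta (fun k => d k * n k)); apply: eq_bigr => k _.
by rewrite ffunE; ring.
Qed.

Lemma pr_scale_l (a : int) (c n : weight I) :
  pr [ffun k => a * c k] n = a * pr c n.
Proof. by rewrite /pr mulr_sumr; apply: eq_bigr => k _; rewrite ffunE; ring. Qed.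

(** The reflection n - <beta^vee, n> beta for beta = r alpha_i, where <beta^vee, n> = (beta, n) /
    d_i; multiplying by [d i] keeps it integral. *)
Lemma wact_reflection r i (n : weight I) j :
  d i * (n j - wact A (r ++ i :: rev r) n j) =
  pr (rwact r (sroot i)) n * rwt (rwact r (sroot i)) j.
Proof.
elim: r n j => [|k r IH] n j /=.
  by rewrite pr_sroot rwt_sroot !ffunE; ring.
set c := rwact r (sroot i); rewrite rev_cons -cats1 -cat_cons catA wact_cat.
rewrite pr_rsref rwt_rsref -/c.
have {}IH := IH (sref A k n).
rewrite -/c in IH; rewrite /=; set T := wact A _ _ in IH *.
rewrite [sref A k T j]ffunE [sref A k (rwt c) j]ffunE.
have -> : n j = sref A k n j - sref A k n k * A j k by rewrite !ffunE A2; ring.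
have Hj := IH j; have Hk := IH k.
transitivity (d i * (sref A k n j - T j) - d i * (sref A k n k - T k) * A j k).
  ring.
rewrite Hj Hk; ring.
Qed.

Lemma pr_rwt_root r i :
  pr (rwact r (sroot i)) (rwt (rwact r (sroot i))) = 2 * d i.
Proof.
rewrite pr_rwact rwt_rwact wact_revKV // rwt_sroot pr_sroot ffunE A2; ring.
Qed.

(** Comparing norms gives d_i = a^2 d_j, which turns the reflection formula into that of s_j. *)
Lemma wact_reflection_multiple r i j (a : int) n :
  rwact r (sroot i) = [ffun k => a * sroot j k] ->
  wact A (r ++ i :: rev r) n = sref A j n.
Proof.
move=> E; have rwtE : rwt (rwact r (sroot i)) = [ffun k => a * alpha A j k].
  rewrite E -rwt_sroot; apply/ffunP => k; rewrite 2!ffunE [rwt _ k]ffunE mulr_sumr.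
  by apply: eq_bigr => k' _; rewrite ffunE; ring.
have := pr_rwt_root r i; rewrite {1}E rwtE pr_scale_l pr_sroot !ffunE A2 => N.
have {}N : d i = a * a * d j by lia.
apply/ffunP => k; have := wact_reflection r i n k.
rewrite {1}E pr_scale_l pr_sroot rwtE !ffunE => H.
have {}H : d i * (n k - wact A (r ++ i :: rev r) n k) = d i * (n j * A k j).
  by rewrite H N; ring.
by move/(mulfI (lt0r_neq0 (d_gt0 i))): H; lia.
Qed.

Hypothesis root_sign : forall w i,
  (forall k, 0 <= rwact w (sroot i) k) \/ (forall k, rwact w (sroot i) k <= 0).

(* The sign of v c changes along the suffixes of v exactly when the suffix maps
   c to (a multiple of) the next simple root; that letter is the one to delete. *)
Lemma exchange v r i :
  (forall k, 0 <= rwact r (sroot i) k) ->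
  (forall k, rwact (v ++ r) (sroot i) k <= 0) ->
  exists v1 j v2, v = v1 ++ j :: v2 /\ weq A (v1 ++ v2) (v ++ r ++ i :: rev r).
Proof.
move=> c_ge0; elim: v => [|j v IH] c_le0.
  case/eqP: (rwact_sroot_neq0 r i); apply/ffunP => k; rewrite ffunE.
  by apply/eqP; rewrite eq_le c_ge0 c_le0.
have [c'_ge0|c'_le0] := root_sign (v ++ r) i; last first.
  have [v1 [j' [v2 [-> E]]]] := IH c'_le0.
  exists (j :: v1), j', v2; split=> // n /=; rewrite E //.
exists [::], j, v; split=> // n /=.
set c' := rwact (v ++ r) (sroot i) in c'_ge0 *.
(* s_j changes only the j-th coordinate; every other one is both >= 0 and <= 0. *)
have E : c' = [ffun k => c' j * sroot j k].
  apply/ffunP => k; rewrite !ffunE; case: eqVneq => [->|kj]; first by rewrite mulr1.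
  rewrite mulr0; apply/eqP; rewrite eq_le c'_ge0 andbT.
  by have := c_le0 k; rewrite /= ffunE (negPf kj) mulr0 subr0.
have := wact_reflection_multiple (wact A v n) E.
rewrite rev_cat -cat_cons !catA wact_cat wact_revKV // -!catA wact_cat -/c'.
by rewrite !wact_cat => ->; rewrite srefK.
Qed.

(** Otherwise pairing with n shows w^-1 alpha_i negative, and exchange deletes a letter of w to give
    a word for s_i w that is too short. *)
Lemma reduced_cons_ge0 i w (n : weight I) : dominant n ->
  reduced A (i :: w) -> 0 <= wact A w n i.
Proof.
move=> n_dom [_ red]; rewrite leNgt; apply/negP => lt0.
pose c := rwact (rev w) (sroot i).
have prc : pr c n < 0 by rewrite pr_rwact revK pr_sroot pmulr_rlt0.
have c_le0 k : c k <= 0.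
  have [c_ge0|//] := root_sign (rev w) i.
  suff : 0 <= pr c n by rewrite leNgt prc.
  apply: sumr_ge0 => k' _; apply: mulr_ge0 (n_dom k').
  by apply: mulr_ge0 (c_ge0 k'); exact: ltW.
have cN : rwact (rev w ++ [:: i]) (sroot i) = - c.
  by rewrite rwact_cat /= rsref_sroot rwactN.
have [||v1 [j [v2 [E H]]]] := @exchange w (rev w ++ [:: i]) i.
- by move=> k; rewrite cN ffunE oppr_ge0.
- move=> k; rewrite rwact_cat cN rwactN rwact_revK !ffunE; lia.
have := red (v1 ++ v2); rewrite E /= !size_cat /=.
suff H' : weq A (v1 ++ v2) (i :: w) by rewrite -E => /(_ H'); lia.
move=> l; rewrite H rev_cat revK /= -!catA /= !wact_cat wact_revK //=.
by rewrite srefK.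
Qed.

(** Write x = y t. If y makes the positive root of t negative, a reduced word of y loses a letter;
    otherwise x does, and y would be shorter than x. *)
Lemma strong_exchange x y : bruhat_step A x y ->
  exists v1 j v2, reduced A (v1 ++ j :: v2) /\
    weq A (v1 ++ j :: v2) y /\ weq A (v1 ++ v2) x.
Proof.
move=> [r [i [yE lt]]].
have tK (r' : seq I) l : wact A (r' ++ i :: rev r') (wact A (r' ++ i :: rev r') l) = l.
  by rewrite !wact_cat /= wact_revKV // srefK // wact_revK.
(* Replacing r by r s_i negates the root and keeps the reflection. *)
wlog c_ge0 : r yE / forall k, 0 <= rwact r (sroot i) k.
  move=> W; have [|c_le0] := root_sign r i; first exact: W.
  apply: (W (r ++ [:: i])).
    move=> l; rewrite yE rev_cat /= -!catA /= !wact_cat /=.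
    by rewrite srefK.
  move=> k; rewrite rwact_cat /= rsref_sroot rwactN ffunE oppr_ge0; exact: c_le0.
have [y' [y'y y'red]] := exists_reduced A y.
have [x' [x'x x'red]] := exists_reduced A x.
have [y_ge0|y_le0] := root_sign (y' ++ r) i; last first.
  have [v1 [j [v2 [E H]]]] := exchange c_ge0 y_le0.
  exists v1, j, v2; rewrite -E; split=> //; split=> // l.
  by rewrite H wact_cat y'y yE wact_cat tK.
have x_le0 k : rwact (x' ++ r) (sroot i) k <= 0.
  suff -> : rwact (x' ++ r) (sroot i) = - rwact (y' ++ r) (sroot i).
    by rewrite ffunE oppr_le0.
  apply: rwt_inj; rewrite rwtN !rwt_rwact !wact_cat y'y yE !wact_cat.
  rewrite /= wact_revKV // x'x rwt_sroot.
  have -> : sref A i (alpha A i) = - alpha A i.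
    by apply/ffunP => k'; rewrite !ffunE A2; ring.
  by rewrite !wactN opprK.
have [v1 [j [v2 [E H]]]] := exchange c_ge0 x_le0.
have lx : is_length A x (size x').
  case: x'red => _ H'; split; first by exists x'.
  by move=> z zx; apply: H' => l; rewrite zx x'x.
have [ny [ly1 ly2]] := exists_length A y.
have := lt _ _ lx (conj ly1 ly2).
have : weq A (v1 ++ v2) y by move=> l; rewrite H yE !wact_cat x'x.
by move/ly2; rewrite E !size_cat /=; lia.
Qed.

End Roots.

Section Crystals.
Variables (I : finType) (A : I -> I -> int) (C : crystal_family I).
Hypothesis A2 : forall i, A i i = 2.
Hypothesis HC : kashiwara_family A C.
Variable d : I -> int.
Hypothesis d_gt0 : forall i, 0 < d i.
Hypothesis dA : forall i j, d i * A i j = d j * A j i.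
Hypothesis posdef : forall x : I -> rat, (exists i, x i != 0) ->
  0 < \sum_i \sum_j x i * ((d i * A i j)%:~R) * x j.

Local Notation eps i b := (strlen (ce i) b).
Local Notation phi i b := (strlen (cf i) b).
Local Notation hw l := (chw C l).
Local Notation ctop i b := (top (ce i) b).
Local Notation dem l w := (demazure (cf (l:=l)) (hw l) w).
Local Notation main l m :=
  (freach (tens_f (cf (l:=l)) (ce (l:=m)) (cf (l:=m))) (hw l, hw m)).

Lemma dominant_wadd (l m : weight I) : dominant l -> dominant m -> dominant (wadd l m).
Proof. by move=> dl dm i; rewrite ffunE addr_ge0. Qed.

(** * Weights and Demazure subsets in a single crystal *)

Section OneCrystal.
Variable l : weight I.
Hypothesis dl : dominant l.

Lemma cfe i (b b' : cB C l) : cf i b = Some b' <-> ce i b' = Some b.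
Proof. by case: HC => /(_ l dl) [H _ _ _ _] _. Qed.

Lemma cwt_cf i (b b' : cB C l) : cf i b = Some b' -> cwt b' = cwt b - alpha A i.
Proof. by case: HC => /(_ l dl) [_ H _ _ _] _ /H ->; rewrite wsubE. Qed.

Lemma cf_dec i (b b' : cB C l) : cf i b = Some b' -> cwt b' i < cwt b i.
Proof. by move/cwt_cf=> ->; rewrite !ffunE A2 gtrDl. Qed.

Lemma ce_inc i (b b' : cB C l) : ce i b = Some b' -> - cwt b' i < - cwt b i.
Proof. by move/cfe/cf_dec; rewrite ltrN2. Qed.

Lemma phi_eps i (b : cB C l) : (phi i b)%:Z - (eps i b)%:Z = cwt b i.
Proof. by case: HC => /(_ l dl) [_ _ H _ _] _; exact: H. Qed.

Lemma cwt_hw : cwt (hw l) = l.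
Proof. by case: HC => /(_ l dl) [_ _ _ [-> _] _]. Qed.

Lemma ce_hw i : ce i (hw l) = None.
Proof. by case: HC => /(_ l dl) [_ _ _ [_ ->] _]. Qed.

Lemma freach_hw (b : cB C l) : freach (cf (l:=l)) (hw l) b.
Proof. by case: HC => /(_ l dl) [_ _ _ _ H] _; exact: H. Qed.

Lemma eps_eq0 i (b : cB C l) : (eps i b == 0%N) = (ce i b == None).
Proof. exact: strlen_eq0 (@ce_inc i) b. Qed.

Lemma phi_eq0 i (b : cB C l) : (phi i b == 0%N) = (cf i b == None).
Proof. exact: strlen_eq0 (@cf_dec i) b. Qed.

Lemma eps_hw i : eps i (hw l) = 0%N.
Proof. by apply/eqP; rewrite eps_eq0 ce_hw. Qed.

Lemma phi_hw i : (phi i (hw l))%:Z = l i.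
Proof. by have := phi_eps i (hw l); rewrite eps_hw cwt_hw subr0. Qed.

Lemma cwt_opow i k (b b' : cB C l) :
  opow (cf i) k b = Some b' -> cwt b' = cwt b - alpha A i *+ k.
Proof.
elim: k b => [|k IH] b; first by case=> ->; rewrite mulr0n subr0.
rewrite opowSr; case E: (cf i b) => [c|//] /IH ->.
by rewrite (cwt_cf E) mulrS opprD addrA.
Qed.

Lemma depth (b : cB C l) : exists2 n : weight I,
  (forall k, 0 <= n k) & cwt b = l - rwt A n.
Proof.
elim: (freach_hw b) => [|c b' i _ [n n_ge0 E] Ef].
  exists 0 => [k|]; first by rewrite ffunE.
  by rewrite cwt_hw (rwtMn A 0 0) mulr0n subr0.
exists (n - - sroot i) => [k|]; first by rewrite !ffunE opprK addr_ge0.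
by rewrite (cwt_cf Ef) E rwtB rwtN rwt_sroot opprK opprD addrA.
Qed.

Lemma depth_uniq (b : cB C l) n k : cwt b = l - rwt A n -> 0 <= n k.
Proof.
move=> E; have [n' n'_ge0] := depth b; rewrite E => /addrI /oppr_inj.
by move/(rwt_inj posdef) ->.
Qed.

(** A predecessor of b under some f_i would have weight l + alpha_i, outside the cone below l. *)
Lemma hw_unique (b : cB C l) : cwt b = l -> b = hw l.
Proof.
case: (freach_hw b) => // {}b b' i _ Ef E.
have bE : cwt b = l - rwt A (- sroot i).
  have := cwt_cf Ef; rewrite E => lE.
  by apply/eqP; rewrite rwtN rwt_sroot opprK -subr_eq -lE.
by have := depth_uniq i bE; rewrite !ffunE eqxx.
Qed.

Lemma cwt_srefl i (b : cB C l) :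
  cwt (srefl (ce i) (cf i) b) = sref A i (cwt b).
Proof.
have topb := opow_top (cfe i) (@cf_dec i) b.
have tops : opow (cf i) (phi i b) (ctop i b) = Some (srefl (ce i) (cf i) b).
  apply/(opow_iterP (@cf_dec i)).
  by rewrite (strlen_f_top (cfe i) (@cf_dec i)) leq_addl.
have subE (a c : weight I) j : (a - c) j = a j - c j by rewrite !ffunE.
have mulE j k : (alpha A i *+ k) j = A j i * k%:Z.
  by rewrite ffunMnE ffunE -mulr_natr natz.
rewrite (cwt_opow tops); apply/ffunP => j; rewrite [RHS]ffunE -(phi_eps i b).
rewrite (cwt_opow topb) !subE !mulE; ring.
Qed.

Lemma cwt_orbit w (b : cB C l) : exists b' : cB C l, cwt b' = wact A w (cwt b).
Proof.
elim: w => [|i w [b' E]]; first by exists b.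
by exists (srefl (ce i) (cf i) b'); rewrite cwt_srefl E.
Qed.

(** A nonzero e_j y would have weight l - k alpha_i + alpha_j, outside the cone below l. *)
Lemma eps_opow_hw i j k (y : cB C l) :
  i != j -> opow (cf i) k (hw l) = Some y -> eps j y = 0%N.
Proof.
move=> ij E; apply/eqP; rewrite eps_eq0; case Ee: (ce j y) => [z|//].
have /cfe /cwt_cf := Ee; rewrite (cwt_opow E) cwt_hw => /esym/eqP.
rewrite subr_eq => /eqP zE.
have := depth_uniq (b := z) (n := sroot i *+ k - sroot j) j.
rewrite rwtB rwtMn !rwt_sroot opprB addrA zE addrAC => /(_ erefl).
by rewrite !ffunE ffunMnE ffunE eq_sym (negPf ij) eqxx mul0rn.
Qed.

Definition estable w := forall i (b b' : cB C l),
  dem l w b -> ce i b = Some b' -> dem l w b'.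

Lemma estable_top w i b : estable w -> dem l w b -> dem l w (ctop i b).
Proof.
move=> est; elim/(top_ind (cfe i) (@cf_dec i)): b => [b Eb|b b' Eb IH] H.
  by rewrite top_id //; apply/eqP; rewrite eps_eq0 Eb.
by rewrite (top_e (cfe i) (@cf_dec i) Eb); apply: IH; apply: est H Eb.
Qed.

Lemma dem_top w i b : dem l w (ctop i b) -> dem l (i :: w) b.
Proof.
by exists (ctop i b), (eps i b); split=> //; exact: opow_top (cfe i) (@cf_dec i) b.
Qed.

(** Elements joined by powers of f_i share their top, and stability carries membership in B_w(l) up
    to it. *)
Lemma dem_consE w i b : estable w -> dem l (i :: w) b <-> dem l w (ctop i b).
Proof.
move=> est; split; last exact: dem_top.
case=> b' [k [/(estable_top i est) H E]].
by rewrite (opow_eq_top (cfe i) (@cf_dec i) E).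
Qed.

End OneCrystal.

(* If w alpha_i had mixed signs, the weights of the crystal of a fundamental
   weight, which are Weyl-invariant, would leave the cone below it. *)
Lemma root_sign w i : (forall k, 0 <= rwact A w (sroot i) k) \/
  (forall k, rwact A w (sroot i) k <= 0).
Proof.
set c := rwact A w (sroot i).
have [k ck] : exists k, c k != 0.
  apply: NNPP => H; case/eqP: (rwact_sroot_neq0 A2 w i).
  apply/ffunP => k; rewrite [RHS]ffunE; apply: NNPP => ck.
  by apply: H; exists k; apply/eqP.
(* In weight coordinates this is the k-th fundamental weight, whose pairing with c isolates the k-th
   coordinate. *)
pose mu : weight I := sroot k.
have dmu : dominant mu by move=> j; rewrite ffunE.
have E : d k * c k = d i * wact A (rev w) mu i.
  rewrite -(pr_sroot d i) -pr_rwact // -/c /pr.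
  rewrite -(sum_delta (fun j => d j * c j)); apply: eq_bigr => j _.
  by rewrite [mu j]ffunE.
have [x xE] := cwt_orbit dmu (rev w) (hw mu); rewrite cwt_hw // in xE.
have := phi_eps dmu i x; rewrite xE => phix.
have [ck_gt0|ck_lt0] : 0 < c k \/ c k < 0 by lia.
- have nu_gt0 : 0 < wact A (rev w) mu i.
    by rewrite -(pmulr_rgt0 _ (d_gt0 i)) -E pmulr_rgt0.
  (* f_i x exists, and w moves its weight to mu - c; lying below mu makes every coordinate of c
     nonnegative. *)
  left=> j; have : phi i x != 0%N by lia.
  rewrite (phi_eq0 dmu); case Ef: (cf i x) => [y|//] _.
  have [z] := cwt_orbit dmu w y; rewrite (cwt_cf dmu Ef) xE wactB wact_revK //.
  by rewrite -rwt_sroot -rwt_rwact => /(depth_uniq dmu j).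
- have nu_lt0 : wact A (rev w) mu i < 0.
    by rewrite -(pmulr_rlt0 _ (d_gt0 i)) -E pmulr_rlt0.
  right=> j; have : eps i x != 0%N by lia.
  rewrite (eps_eq0 dmu); case Ee: (ce i x) => [y|//] _.
  have [z] := cwt_orbit dmu w y.
  have -> : cwt y = wact A (rev w) mu - - alpha A i.
    by have /(cfe dmu) /(cwt_cf dmu) := Ee; rewrite xE opprK => ->; rewrite subrK.
  rewrite wactB wactN wact_revK // -rwt_sroot -rwt_rwact -rwtN.
  by move=> /(depth_uniq dmu j); rewrite ffunE oppr_ge0.
Qed.

(** * The main component of a tensor product *)

Section Tensor.
Variables l m : weight I.
Hypotheses (dl : dominant l) (dm : dominant m).
Variable psi : cB C (wadd l m) -> cB C l * cB C m.
Hypothesis Hpsi : comp_iso psi.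
Let dlm := dominant_wadd dl dm.

Lemma psi_cf i b b' : cf i b = Some b' ->
  [/\ (eps i (psi b).2 < phi i (psi b).1)%N, cf i (psi b).1 = Some (psi b').1 &
      (psi b').2 = (psi b).2] \/
  [/\ (phi i (psi b).1 <= eps i (psi b).2)%N, cf i (psi b).2 = Some (psi b').2 &
      (psi b').1 = (psi b).1].
Proof.
case: Hpsi => _ _ /(_ i b) + _ _ E; rewrite E /= /tens_f.
case: ltnP => le; case: (cf i _) => //= x [->]; [left|right]; by split.
Qed.

Lemma psi_ce i b b' : ce i b = Some b' ->
  [/\ (eps i (psi b).2 <= phi i (psi b).1)%N, ce i (psi b).1 = Some (psi b').1 &
      (psi b').2 = (psi b).2] \/
  [/\ (phi i (psi b).1 < eps i (psi b).2)%N, ce i (psi b).2 = Some (psi b').2 &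
      (psi b').1 = (psi b).1].
Proof.
case: Hpsi => _ _ _ /(_ i b) + _ E; rewrite E /= /tens_e.
case: leqP => le; case: (ce i _) => //= x [->]; [left|right]; by split.
Qed.

Lemma psi_ceN i b : ce i b = None ->
  (eps i (psi b).2 <= phi i (psi b).1)%N /\ ce i (psi b).1 = None.
Proof.
case: Hpsi => _ _ _ /(_ i b) + _ E; rewrite E /= /tens_e.
case: leqP => le; first by case: (ce i _).
case E2: (ce i (psi b).2) => [//|] _.
have : eps i (psi b).2 == 0%N by rewrite (eps_eq0 dm) E2.
by move/eqP=> e0; rewrite e0 in le.
Qed.

Lemma main_psi x : main l m x <-> exists b, psi b = x.
Proof. by case: Hpsi => _ + _ _ _; apply. Qed.

Lemma psi_hw : psi (hw (wadd l m)) = (hw l, hw m).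
Proof.
have [b0 E] : exists b, psi b = (hw l, hw m) by apply/main_psi; exact: freach0.
rewrite -E; congr psi; case: (freach_hw dlm b0) E => // b b' i _ /(cfe dlm) Ee E.
by case: (psi_ce Ee) => -[_]; rewrite E /= ce_hw.
Qed.

Lemma main_step1 i x y : (eps i y < phi i x)%N -> main l m (x, y) ->
  main l m (step (cf i) x, y).
Proof.
move=> lt H; have [E _ _] := strlen_step (cfe dl i) (@cf_dec l dl i) (leq_ltn_trans (leq0n _) lt).
by apply: (freachS (i := i) H); rewrite /tens_f /= lt E.
Qed.

Lemma main_step2 i x y : (phi i x <= eps i y)%N -> main l m (x, y) ->
  main l m (x, step (cf i) y).
Proof.
move=> le H; rewrite /step; case E: (cf i y) => [y'|//].
by apply: (freachS (i := i) H); rewrite /tens_f /= ltnNge le E.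
Qed.

(* e_i only reaches the first factor after exhausting the excess of the second
   one, so the top of a tensor has the top of the first factor. *)
Lemma psi_top i b : (psi (ctop i b)).1 = ctop i (psi b).1.
Proof.
elim/(top_ind (cfe dlm i) (@cf_dec _ dlm i)): b => [b Eb|b b' Eb].
  rewrite top_id; last by apply/eqP; rewrite (eps_eq0 dlm) Eb.
  by have [_ Eb1] := psi_ceN Eb; rewrite top_id //; apply/eqP; rewrite (eps_eq0 dl) Eb1.
rewrite (top_e (cfe dlm i) (@cf_dec _ dlm i) Eb) => ->.
case: (psi_ce Eb) => -[_ E E2]; last by rewrite E2.
by rewrite (top_e (cfe dl i) (@cf_dec _ dl i) E).
Qed.

Lemma psi_top2 i b : phi i (psi b).1 = 0%N -> (psi (ctop i b)).2 = ctop i (psi b).2.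
Proof.
(* The disjunction survives the induction: the second factor is raised while phi_i of the first is
   zero, the first only once eps_i of the second is zero. *)
move=> phi0; have : phi i (psi b).1 = 0%N \/ eps i (psi b).2 = 0%N by left.
elim/(top_ind (cfe dlm i) (@cf_dec _ dlm i)): b {phi0} => [b Eb|b b' Eb IH] H.
  rewrite top_id; last by apply/eqP; rewrite (eps_eq0 dlm) Eb.
  by have [le _] := psi_ceN Eb; rewrite top_id //; case: H => e0 //; lia.
rewrite (top_e (cfe dlm i) (@cf_dec _ dlm i) Eb).
case: (psi_ce Eb) => -[le E E2].
  by rewrite IH E2 //; right; case: H => // H; lia.
rewrite (top_e (cfe dm i) (@cf_dec _ dm i) E) IH // E2; left.
by case: H => // H; lia.
Qed.

Lemma psi_opow i k b b' : opow (cf i) k b = Some b' ->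
  (exists k1, opow (cf i) k1 (psi b).1 = Some (psi b').1) /\
  (exists k2, opow (cf i) k2 (psi b).2 = Some (psi b').2).
Proof.
elim: k b => [|k IH] b; first by case=> <-; split; exists 0%N.
rewrite opowSr; case E: (cf i b) => [c|//] /IH [[k1 H1] [k2 H2]].
case: (psi_cf E) => -[_ Ef Ee].
  by split; [exists k1.+1; rewrite opowSr Ef | exists k2; rewrite -Ee].
by split; [exists k1; rewrite -Ee | exists k2.+1; rewrite opowSr Ef].
Qed.

(** [z] is a tail that leaves the first factor at b_l: one letter in [estable_split], empty
    elsewhere. *)
Lemma dem_psi1 w z b : (forall b, dem (wadd l m) z b -> (psi b).1 = hw l) ->
  dem (wadd l m) (w ++ z) b -> dem l w (psi b).1.
Proof.
move=> Hz; elim: w b => [|i w IH] b; first exact: Hz.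
case=> b' [k [/IH H /psi_opow [[k1 E] _]]].
by exists (psi b').1, k1.
Qed.

Lemma dem_psi2 w b : dem (wadd l m) w b -> dem m w (psi b).2.
Proof.
elim: w b => [|i w IH] b; first by move=> ->; rewrite psi_hw.
case=> b' [k [/IH H /psi_opow [_ [k2 E]]]].
by exists (psi b').2, k2.
Qed.

(** Stability is asked of shorter words only, so that induction on length can supply it in
    [demazure_estable]. *)
Lemma dem_psi1_conv w z b :
  (forall w', (size w' < size w)%N -> estable l w') ->
  (forall b, (psi b).1 = hw l -> dem (wadd l m) z b) ->
  dem l w (psi b).1 -> dem (wadd l m) (w ++ z) b.
Proof.
move=> est Hz; elim: w b est => [|i w IH] b est; first exact: Hz.
move/(dem_consE dl _ _ (est w (ltnSn _))); rewrite -psi_top => H.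
apply: (dem_top dlm); apply: IH H => w' lt; apply: est.
by rewrite ltnS ltnW.
Qed.

(** f_i moves the second factor of b_l (x) b_m only if phi_i(b_l) = l_i = 0; then m_i = 0 and f_i
    kills b_m. *)
Lemma psi1_hw b : (forall i, l i = 0 -> m i = 0) -> (psi b).1 = hw l ->
  b = hw (wadd l m).
Proof.
move=> lm0; elim: (freach_hw dlm b) => // {}b b' i _ IH Ef E.
case: (psi_cf Ef) => -[le Ef' E'].
  by move/(cfe dl): Ef'; rewrite E ce_hw.
move: E'; rewrite E => /esym /IH b_hw; move: le Ef'; rewrite b_hw psi_hw /=.
rewrite eps_hw // leqn0 => /eqP phi0.
have l0 : l i = 0 by rewrite -phi_hw // phi0.
have : phi i (hw m) == 0%N by have := phi_hw dm i; rewrite lm0 //; lia.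
by rewrite (phi_eq0 dm) => /eqP ->.
Qed.

Lemma psi1_hw_string i b : l i = 0 -> (forall j, j != i -> 0 < l j) ->
  (psi b).1 = hw l -> dem (wadd l m) [:: i] b.
Proof.
move=> li0 lj E.
suff [k [H _]] : exists k, opow (cf i) k (hw (wadd l m)) = Some b /\
    opow (cf i) k (hw m) = Some (psi b).2 by exists (hw (wadd l m)), k.
elim: (freach_hw dlm b) E => [_|{}b b' j _ IH Ef E].
  by exists 0%N; rewrite psi_hw.
case: (psi_cf Ef) => -[le Ef' E'].
  by move/(cfe dl): Ef'; rewrite E ce_hw.
move: E'; rewrite E => /esym E'; have [k [H1 H2]] := IH E'.
have [ji|ji] := eqVneq j i.
  by exists k.+1; rewrite -ji in H1 H2 *; rewrite /opow !iterS -!/(opow _ _ _) H1 H2.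
(* For j other than i, eps_j of f_i^k b_m is zero, so f_j acting on the second factor would force
   l_j = 0. *)
move: le; rewrite E' (eps_opow_hw dm _ H2) 1?eq_sym // leqn0 => /eqP phi0.
by have := lj j ji; rewrite -phi_hw // phi0.
Qed.

Lemma estable_split i w : l i = 0 -> (forall j, j != i -> 0 < l j) ->
  (forall w', (size w' <= size w)%N -> estable l w') ->
  estable (wadd l m) (w ++ [:: i]).
Proof.
move=> li0 lj est.
(* As l_i = 0, f_i kills b_l, so the last letter acts on the second factor only. *)
have zE b : dem (wadd l m) [:: i] b -> (psi b).1 = hw l.
  case=> _ [k [-> /psi_opow [[k1 E] _]]]; rewrite psi_hw /= in E.
  have phi0 : phi i (hw l) = 0%N by have := phi_hw dl i; rewrite li0; lia.
  by move/(opow_iterP (@cf_dec l dl i)): E; rewrite phi0 leqn0 => -[/eqP -> ->].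
move=> j b b' H Ee; apply: dem_psi1_conv => [w' lt||]; [exact/est/ltnW | |].
  by move=> c; apply: psi1_hw_string.
have {}H := dem_psi1 zE H.
by case: (psi_ce Ee) => -[_ E E'] //; [apply: est H E | rewrite E'].
Qed.

(* The first factor embeds in the tensor as b |-> b (x) b_m, compatibly with
   the e_i and with the nonzero f_i. *)
Lemma estable_shift w : estable (wadd l m) w -> estable l w.
Proof.
have embed b : exists2 b0, psi b0 = (b, hw m) & dem l w b -> dem (wadd l m) w b0.
  have ex c : exists c0, psi c0 = (c, hw m).
    apply/main_psi; elim: (freach_hw dl c) => [|{}c c' i _ H E]; first exact: freach0.
    apply: (freachS (i := i) H); rewrite /tens_f /= eps_hw // E.
    by rewrite (strlen_Some (@cf_dec l dl i) E).
  have [b0 E0] := ex b; exists b0 => //.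
  case: Hpsi => psi_inj _ psif _ _.
  elim: w b b0 E0 => [|i w IH] b b0 E0.
    by move=> bE; apply: psi_inj; rewrite E0 bE psi_hw.
  case=> b' [k [H E]]; have [b0' E0'] := ex b'; exists b0', k; split.
    exact: IH E0' H.
  elim: k b' b0' E E0' {H} => [|k IHk] b' b0'.
    by case=> ->; rewrite -E0 => /psi_inj ->.
  rewrite !opowSr; case Ef: (cf i b') => [c|//] Ec E0'.
  have := psif i b0'; rewrite E0' /tens_f /= eps_hw //.
  rewrite (strlen_Some (@cf_dec l dl i) Ef) Ef /=.
  by case: (cf i b0') => //= c0 [Ec0]; apply: IHk Ec Ec0.
move=> est j b b' H Ee; have [b0 E0 Hb0] := embed b.
have : exists b0', ce j b0 = Some b0'.
  case Ee0: (ce j b0) => [b0'|]; first by exists b0'.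
  by have [_] := psi_ceN Ee0; rewrite E0 Ee.
case=> b0' Ee0; have {}H := est _ _ _ (Hb0 H) Ee0.
case: (psi_ce Ee0) => -[lt E1 E2].
  move: E1; rewrite E0 Ee => -[->]; rewrite -[w]cats0 in H.
  by apply: dem_psi1 H => c ->; rewrite psi_hw.
by move: lt; rewrite E0 /= eps_hw.
Qed.

End Tensor.

(** * Stability of Demazure subsets under the e_i *)

Local Notation rho := ([ffun=> 1] : weight I).

Lemma dominant_rho : dominant rho.
Proof. by move=> i; rewrite ffunE. Qed.

Lemma exists_psi (l m : weight I) : dominant l -> dominant m ->
  exists psi : cB C (wadd l m) -> cB C l * cB C m, comp_iso psi.
Proof. by move=> dl dm; case: HC => _; exact. Qed.

(* For regular weights the last letter i of the word is peeled off by splitting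
   off the multiple of the i-th fundamental weight into a second tensor factor:
   membership in the Demazure subset is then read on the first factor only. *)
Lemma demazure_estable w (l : weight I) : dominant l -> estable l w.
Proof.
have [n] := ubnP (size w); elim: n w l => // n IH w l lt dl.
case/lastP: w lt => [|w i]; first by move=> _ i b b' ->; rewrite ce_hw.
rewrite size_rcons ltnS -cats1 => lt.
(* Passing to l + rho makes the weight regular; the induction ranges over all dominant weights
   because it is then applied to [l1]. *)
have [psi Hpsi] := exists_psi dl dominant_rho.
apply: (estable_shift dl dominant_rho Hpsi).
pose l1 : weight I := [ffun j => if j == i then 0 else l j + 1].
pose l2 : weight I := [ffun j => if j == i then l j + 1 else 0].
have dl1 : dominant l1 by move=> j; rewrite ffunE; have := dl j; case: eqP; lia.
have dl2 : dominant l2 by move=> j; rewrite ffunE; have := dl j; case: eqP; lia.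
have -> : wadd l rho = wadd l1 l2.
  by apply/ffunP => j; rewrite !ffunE; case: eqP => _; rewrite ?add0r ?addr0.
have [psi' Hpsi'] := exists_psi dl1 dl2.
apply: (estable_split dl1 dl2 Hpsi'); first by rewrite ffunE eqxx.
  by move=> j /negPf ji; rewrite ffunE ji; have := dl j; lia.
by move=> w' lew; apply: IH => //; apply: leq_ltn_trans lew lt.
Qed.

(** If e_i x existed, w^-1 would move its weight to rho + w^-1 alpha_i, so w^-1 alpha_i <= 0; its
    pairing with rho being nonnegative, it would vanish. *)
Lemma eps_extremal w i (x : cB C rho) : cwt x = wact A w rho ->
  0 <= wact A w rho i -> eps i x = 0%N.
Proof.
move=> xE ge0; apply/eqP; rewrite (eps_eq0 dominant_rho).
case Ee: (ce i x) => [y|//].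
pose c := rwact A (rev w) (sroot i).
have [z] := cwt_orbit dominant_rho (rev w) y.
have -> : cwt y = wact A w rho - - alpha A i.
  have /(cfe dominant_rho) /(cwt_cf dominant_rho) := Ee.
  by rewrite xE opprK => ->; rewrite subrK.
rewrite wactB wactN wact_revKV // -rwt_sroot -rwt_rwact -rwtN -/c => zE.
have c_le0 k : c k <= 0.
  by have := depth_uniq dominant_rho k zE; rewrite ffunE oppr_ge0.
have prE : pr d c rho = d i * wact A w rho i.
  by rewrite pr_rwact // revK pr_sroot.
case/eqP: (rwact_sroot_neq0 A2 (rev w) i); apply/ffunP => k; rewrite [RHS]ffunE -/c.
have ge0' j : 0 <= d j * - c j by rewrite mulr_ge0 ?oppr_ge0 // ltW.
have pr0 : \sum_k d k * - c k = 0.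
  apply/eqP; rewrite eq_le sumr_ge0 ?andbT //.
  have -> : \sum_k d k * - c k = - pr d c rho.
    by rewrite /pr -sumrN; apply: eq_bigr => j _; rewrite [rho j]ffunE; ring.
  by rewrite prE oppr_le0 mulr_ge0 // ltW.
have /eqP : d k * - c k = 0 by apply: (psumr_eq0P _ pr0).
by rewrite mulf_eq0 gt_eqF //= oppr_eq0 => /eqP.
Qed.

(** * Demazure subsets through extremal weights; Bruhat monotonicity *)

Section DemazureByExtremal.
Variable l : weight I.
Hypothesis dl : dominant l.

(* The word enters only through the extremal weight w rho, so that this
   description of the Demazure subset depends on the Weyl group element alone. *)
Definition extdem w (b : cB C l) : Prop :=
  exists x : cB C rho, cwt x = wact A w rho /\ main rho l (x, b).

Let drho := dominant_rho.

Lemma extdem_weq w w' b : weq A w w' -> extdem w b -> extdem w' b.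
Proof. by move=> E [x [xE H]]; exists x; rewrite -E. Qed.

Lemma main_iter1 i k (x : cB C rho) (b : cB C l) : eps i b = 0%N ->
  main rho l (x, b) -> main rho l (iter k (step (cf i)) x, b).
Proof.
move=> e0; elim: k => //= k IH /IH {}IH.
have [phi0|phi_gt0] := posnP (phi i (iter k (step (cf i)) x)).
  by rewrite (step_id (@cf_dec _ drho i) phi0).
by apply: main_step1 => //; rewrite e0.
Qed.

Lemma main_iter2 i k (x : cB C rho) (b : cB C l) : phi i x = 0%N ->
  main rho l (x, b) -> main rho l (x, iter k (step (cf i)) b).
Proof.
move=> phi0; elim: k => //= k IH /IH {}IH.
by apply: main_step2 => //; rewrite phi0.
Qed.

Lemma srefl_hi i (x : cB C rho) : eps i x = 0%N ->
  srefl (ce i) (cf i) x = iter (phi i x) (step (cf i)) x.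
Proof. by move=> e0; rewrite /srefl top_id. Qed.

(** String reflection exchanges the weights w rho and s_i w rho of x. Going down, f_i exhausts x
    before lowering the top of b; going up, e_i exhausts b before x. *)
Lemma extdem_cons i w b : 0 <= wact A w rho i ->
  extdem (i :: w) b <-> extdem w (ctop i b).
Proof.
move=> ge0; have [psi Hpsi] := exists_psi drho dl.
pose s := @srefl (cB C rho) (ce i) (cf i).
split=> [[x [xE H]]|[x [xE H]]].
  have sxE : cwt (s x) = wact A w rho by rewrite cwt_srefl // xE srefK.
  have e0 := eps_extremal sxE ge0.
  have [E1 E2 E3] := sreflP (cfe drho i) (@cf_dec _ drho i) x.
  have phi0 : phi i x = 0%N by rewrite -E1.
  exists (s x); split=> //.
  move/(main_psi Hpsi): H => [b0 b0E]; apply/(main_psi Hpsi).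
  exists (ctop i b0); apply: injective_projections => /=.
    by rewrite (psi_top drho dl Hpsi) b0E /= -E3 top_id.
  by rewrite (psi_top2 drho dl Hpsi) b0E.
have e0 := eps_extremal xE ge0.
exists (s x); split; first by rewrite cwt_srefl // xE.
rewrite -(iter_step_top (cfe dl i) (@cf_dec _ dl i) b).
have [_ E2 _] := sreflP (cfe drho i) (@cf_dec _ drho i) x.
apply: main_iter2; first by rewrite E2.
rewrite /s srefl_hi //; apply: main_iter1 H.
exact: strlen_e_top (cfe dl i) (@cf_dec _ dl i) b.
Qed.

(** Both sides obey the same recursion in the first letter; for the empty word x is b_rho, and
    regularity of rho forces b = b_l. *)
Lemma extdem_reduced w b : reduced A w -> extdem w b <-> dem l w b.
Proof.
elim: w b => [|i w IH] b red.
  have [psi Hpsi] := exists_psi drho dl.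
  split=> [[x [xE H]]|->]; last by exists (hw rho); rewrite cwt_hw //; split=> //; exact: freach0.
  move: H; rewrite (hw_unique drho xE) => /(main_psi Hpsi) [b0 E].
  have := psi1_hw drho dl Hpsi (b := b0); rewrite E => b0E.
  move: E; rewrite b0E //; last by move=> i; rewrite ffunE.
  by rewrite (psi_hw drho dl Hpsi) => -[].
have red' := reduced_tail red.
have ge0 := reduced_cons_ge0 A2 d_gt0 dA root_sign dominant_rho red.
by rewrite extdem_cons // IH // dem_consE //; apply: demazure_estable.
Qed.

Lemma extdem_top w i b : extdem w b -> extdem w (ctop i b).
Proof.
have [z [zw red]] := exists_reduced A w.
move=> H; apply: (extdem_weq zw); apply/(extdem_reduced _ red).
apply: estable_top => //; first exact: demazure_estable.
by apply/(extdem_reduced _ red); apply: extdem_weq H => n; rewrite zw.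
Qed.

(** Deleting a letter may leave a word that is not reduced, so this inclusion is proved for all
    words. *)
Lemma extdem_sub w b : extdem w b -> dem l w b.
Proof.
elim: w b => [|i w IH] b.
  by move/extdem_reduced; apply; split=> //; exists [::].
move=> H; apply: (dem_top dl); apply: IH.
have [ge0|lt0] := lerP 0 (wact A w rho i); first by apply/extdem_cons.
(* Here s_i w rho pairs positively with the i-th coroot, so x tops its string and reflects to weight
   w rho. *)
have [x [xE {}H]] := extdem_top i H.
have e0 : eps i x = 0%N.
  apply: eps_extremal xE _; rewrite /= ffunE A2.
  by rewrite -{1}[wact A w rho i]mulr1 -mulrBr nmulr_rge0.
exists (srefl (ce i) (cf i) x); split; first by rewrite cwt_srefl // xE srefK.
rewrite srefl_hi //; apply: main_iter1 H.
exact: strlen_e_top (cfe dl i) (@cf_dec _ dl i) b.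
Qed.

Lemma dem_delete w1 j w2 b : dem l (w1 ++ w2) b -> dem l (w1 ++ j :: w2) b.
Proof.
elim: w1 b => [|i w1 IH] b /=; first by move=> H; exists b, 0%N.
by move=> [b' [k [H E]]]; exists b', k; split=> //; apply: IH.
Qed.

Lemma extdem_bruhat u v b : bruhat_le A u v -> extdem u b -> extdem v b.
Proof.
move=> uv Hu; elim: uv => [{}v uv|w {}v _ IH].
  exact: extdem_weq uv Hu.
case/(strong_exchange A2 d_gt0 dA posdef root_sign) => [v1 [j [v2 [red [vE wE]]]]].
(* [v1 ++ v2] represents the lower element, and restoring the letter [j] only enlarges the Demazure
   subset. *)
apply: (extdem_weq vE); apply/(extdem_reduced _ red); apply: dem_delete.
by apply: extdem_sub; apply: extdem_weq IH => n; rewrite wE.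
Qed.

Lemma dem_bruhat u v b : reduced A u -> reduced A v -> bruhat_le A u v ->
  dem l u b -> dem l v b.
Proof.
move=> ru rv uv /(extdem_reduced _ ru) H.
by apply/(extdem_reduced _ rv); apply: extdem_bruhat H.
Qed.

End DemazureByExtremal.
End Crystals.

Theorem theorem9p2 (I : finType) (A : I -> I -> int) (C : crystal_family I)
  (l m : weight I) (u v : seq I) :
  finite_cartan A -> kashiwara_family A C ->
  dominant l -> dominant m -> (forall i, l i = 0 -> m i = 0) ->
  reduced A u -> reduced A v -> bruhat_le A u v ->
  forall psi : cB C (wadd l m) -> cB C l * cB C m,
  comp_iso psi ->
  forall b : cB C (wadd l m),
    demazure (cf (l:=wadd l m)) (chw C (wadd l m)) u b <->
    (demazure (cf (l:=l)) (chw C l) u (psi b).1 /\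
     demazure (cf (l:=m)) (chw C m) v (psi b).2).
Proof.
move=> [A2 _ _ [d [d_gt0 dA posdef]]] HC dl dm lm0 ru rv uv psi Hpsi b.
split=> [H|[H _]].
  (* The second factor lies in B_u(m), hence in B_v(m) by Bruhat monotonicity. *)
  split; last first.
    apply: (dem_bruhat A2 HC d_gt0 dA posdef dm ru rv uv).
    exact: (dem_psi2 HC dl dm Hpsi).
  rewrite -[u]cats0 in H.
  by apply: (dem_psi1 Hpsi) H => c ->; rewrite (psi_hw HC dl dm Hpsi).
(* The empty tail is admissible by [psi1_hw], where the condition relating l and m enters. *)
rewrite -[u]cats0; apply: (dem_psi1_conv A2 HC dl dm Hpsi) H => [w' _|c].
  exact: (demazure_estable A2 HC posdef).
exact: (psi1_hw A2 HC dl dm Hpsi).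
Qed.
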